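(* For positive integers $n,k$ with $1\le k\le n$, the polynomials $B_{n,k}(t)$ and $B_{n,\overline{k}}(t)$ are real-rooted.
   Context: $\mathfrak{B}_n$ is the group of signed permutations: permutations $\pi$ of $\{\pm1,\dots,\pm n\}$ with $\pi(-i)=-\pi(i)$; write $\pi_i=\pi(i)$, $\pi_0=0$, and $\overline{k}=-k$. For $\pi\in\mathfrak{B}_n$, $\mathrm{des}_B(\pi)=|\{i\in\{0,1,\dots,n-1\}:\pi_i>\pi_{i+1}\}|$. For $k\in\{\pm1,\dots,\pm n\}$ let $\mathfrak{B}_{n,k}=\{\pi\in\mathfrak{B}_n:\pi_1=k\}$ and $B_{n,k}(t)=\sum_{\pi\in\mathfrak{B}_{n,k}}t^{\mathrm{des}_B(\pi)}$. A polynomial is real-rooted if all its (complex) roots are real (nonzero constants are real-rooted). *)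

(* Defs.v *)
From HB Require Import structures.
From mathcomp Require Import all_boot all_order all_algebra all_fingroup.
From mathcomp Require Import complex reals.

Set Implicit Arguments.
Unset Strict Implicit.
Unset Printing Implicit Defensive.

Import Order.TTheory GRing.Theory Num.Theory.
Local Open Scope ring_scope.

(* The pair (i, s) encodes the element (-1)^s (i + 1) of {-n, ..., -1, 1, ..., n}. *)
Definition letter (n : nat) : finType := ('I_n * bool)%type.

Definition letter_val (n : nat) (x : letter n) : int :=
  (-1) ^+ x.2 * (x.1.+1)%:Z.

Definition letter_opp (n : nat) (x : letter n) : letter n := (x.1, ~~ x.2).

Lemma letter_val_opp (n : nat) (x : letter n) :
  letter_val (letter_opp x) = - letter_val x.
Proof. by rewrite /letter_val signrN mulNr. Qed.

Lemma letter_val_inj (n : nat) : injective (@letter_val n).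
Proof.
move=> [i b] [j c]; rewrite /letter_val /= => e.
have eij : i = j.
  apply: val_inj; have := congr1 absz e.
  by rewrite !abszMsign !absz_nat => -[].
rewrite -{}eij in e *; congr pair.
have p0 : (i.+1)%:Z != 0 :> int by [].
by have := mulIf p0 e; case: b c {e} => [] [].
Qed.

Lemma letter_valP (n : nat) (k : int) :
  reflect (exists x : letter n, letter_val x = k) (0 < absz k <= n)%N.
Proof.
apply: (iffP idP) => [/andP[k0 kn]|[[i b] <-]]; last first.
  by rewrite /letter_val abszMsign absz_nat /= ltn_ord.
have lt_k : (`|k|.-1 < n)%N by rewrite prednK.
exists (Ordinal lt_k, k < 0).
by rewrite /letter_val /= prednK // -intEsign.
Qed.

Definition signed_perms (n : nat) : {set {perm (letter n)}} :=
  [set pi : {perm (letter n)} |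
    [forall x, pi (letter_opp x) == letter_opp (pi x)]].

(* The sequence pi_0 pi_1 ... pi_n, with pi_0 = 0: (i, false) encodes i + 1. *)
Definition window (n : nat) (pi : {perm (letter n)}) : seq int :=
  0 :: [seq letter_val (pi (i, false)) | i : 'I_n].

Lemma nth_window (n : nat) (pi : {perm (letter n)}) (i : 'I_n) :
  (window pi)`_i.+1 = letter_val (pi (i, false)).
Proof.
by rewrite /window /= (nth_map i) ?nth_ord_enum ?size_enum_ord.
Qed.

Definition desB (n : nat) (pi : {perm (letter n)}) : nat :=
  #|[set i : 'I_n | (window pi)`_i > (window pi)`_i.+1]|.

Definition signed_perms_first (n : nat) (k : int) : {set {perm (letter n)}} :=
  [set pi in signed_perms n | (window pi)`_1 == k].

Definition B_poly (R : realType) (n : nat) (k : int) : {poly R} :=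
  \sum_(pi in signed_perms_first n k) 'X^(desB pi).

(* For [z : R[i]], [z \is Num.real] says that the imaginary part of z is 0. The zero
   polynomial is not real-rooted in this sense. *)
Definition real_rooted (R : realType) (p : {poly R}) : Prop :=
  forall z : R[i], root (map_poly (real_complex R) p) z -> z \is Num.real.

(* Main.v *)
Require Import Defs.
From mathcomp Require Import all_boot all_order all_algebra all_fingroup.
From mathcomp Require Import complex reals.
From mathcomp Require Import ring zify.

Set Implicit Arguments.
Unset Strict Implicit.
Unset Printing Implicit Defensive.

Import Order.TTheory GRing.Theory Num.Theory.
Local Open Scope ring_scope.

(** For z in the open upper half-plane, say that v follows u when arg(v/u) lies in
    [0, arg z], i.e. Im(v u^* ) >= 0 and Im(z u v^* ) >= 0. Both conditions are linear
    over the nonnegative reals in u and in v. Deleting the first letter of a signed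
    permutation expresses each B_{n+1,k} as the sum of the B_{n,j}, with a factor t on
    those j which come before a threshold in the order 1, ..., n, -n, ..., -1;
    the threshold is nondecreasing in k for this same order. If values f_i pairwise
    follow each other, so do the sums g_m = z \sum_(i < m) f_i + \sum_(i >= m) f_i,
    and these do not vanish if the f_i do not. By induction, the values B_{n,k}(z)
    pairwise follow each other and are nonzero, so that B_{n,k} has no root in the
    upper half-plane, nor, by conjugation, in the lower one. *)

(** * The sector relation and its closure properties *)

Section Sector.
Variables (C : numClosedFieldType) (z : C).
Hypothesis z_gt0 : 0 < 'Im z.

Definition in_sector (u v : C) : bool :=
  (0 <= 'Im (v * u^*)) && (0 <= 'Im (z * u * v^*)).

Lemma Im_mul_norm (a u : C) : 'Im (a * u * u^*) = 'Im a * `|u| ^+ 2.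
Proof.
by rewrite -mulrA -normCK mulrC ImMl ?rpredX ?normr_real // mulrC.
Qed.

Lemma in_sector_refl u : in_sector u u.
Proof.
rewrite /in_sector -[u in u * _]mul1r !Im_mul_norm.
by rewrite (Creal_ImP _ _) ?rpred1 // mul0r lexx mulr_ge0 ?exprn_ge0 // ltW.
Qed.

(** The angle from [v] to [z * u] is arg z minus the angle from [u] to [v]: the two conditions swap,
    up to the factor |z|^2. *)
Lemma in_sector_mul u v : in_sector u v -> in_sector v (z * u).
Proof.
rewrite /in_sector => /andP[uv ->] /=.
by rewrite rmorphM mulrACA -normCK ImMl ?rpredX ?normr_real // mulr_ge0 ?exprn_ge0.
Qed.

Lemma in_sector0l v : in_sector 0 v.
Proof. by rewrite /in_sector rmorph0 !(mulr0, mul0r) raddf0 lexx. Qed.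

Lemma in_sector0r u : in_sector u 0.
Proof. by rewrite /in_sector rmorph0 !(mulr0, mul0r) raddf0 lexx. Qed.

Lemma in_sectorDl u1 u2 v :
  in_sector u1 v -> in_sector u2 v -> in_sector (u1 + u2) v.
Proof.
rewrite /in_sector => /andP[? ?] /andP[? ?].
by rewrite rmorphD !(mulrDr, mulrDl) !raddfD !addr_ge0.
Qed.

Lemma in_sectorDr u v1 v2 :
  in_sector u v1 -> in_sector u v2 -> in_sector u (v1 + v2).
Proof.
rewrite /in_sector => /andP[? ?] /andP[? ?].
by rewrite rmorphD !(mulrDr, mulrDl) !raddfD !addr_ge0.
Qed.

Lemma in_sector_sum (I J : finType) (P : pred I) (Q : pred J)
    (f : I -> C) (g : J -> C) :
  (forall i j, P i -> Q j -> in_sector (f i) (g j)) ->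
  in_sector (\sum_(i | P i) f i) (\sum_(j | Q j) g j).
Proof.
move=> fg; elim/big_ind: _ => [|u1 u2|i Pi]; first exact: in_sector0l.
  exact: in_sectorDl.
elim/big_ind: _ => [|v1 v2|j Qj]; [exact: in_sector0r|exact: in_sectorDr|].
exact: fg.
Qed.

(** Expand both products. In the first, the cross terms of [z * a] with [c] are conjugate to each
    other, so their sum is real; in the second, grouping [z * a + c] yields its squared norm times
    [z]. What remains is a sum of nonnegative multiples of the given imaginary parts and of
    ['Im z]. *)
Lemma in_sector_step (a b c : C) :
  in_sector a b -> in_sector a c -> in_sector b c ->
  in_sector (z * a + b + c) (z * a + z * b + c).
Proof.
move=> ab ac bc.
have nz (w : C) : 'Im (`|z| ^+ 2 * w) = `|z| ^+ 2 * 'Im w.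
  by rewrite ImMl ?rpredX ?normr_real.
have z2 : 0 <= `|z| ^+ 2 by rewrite exprn_ge0.
case/andP: ab => ab1 ab2; case/andP: ac => ac1 ac2; case/andP: bc => bc1 bc2.
apply/andP; split.
  have -> : 'Im ((z * a + z * b + c) * (z * a + b + c)^*) =
    'Im (z * a * b^*) + `|z| ^+ 2 * 'Im (b * a^*) + 'Im z * `|b| ^+ 2
    + 'Im (z * b * c^*) + 'Im (c * b^*).
    rewrite -nz -Im_mul_norm normCK !ImE !(rmorphD, rmorphM) /= ?conjCK /=; ring.
  by rewrite !addr_ge0 // mulr_ge0 // ?exprn_ge0 // ltW.
have -> : 'Im (z * (z * a + b + c) * (z * a + z * b + c)^*) =
    'Im z * `|z * a + c| ^+ 2 + `|z| ^+ 2 * 'Im (z * a * b^*)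
    + `|z| ^+ 2 * 'Im (b * a^*) + 'Im (z * b * c^*) + `|z| ^+ 2 * 'Im (c * b^*).
  rewrite -!nz -Im_mul_norm normCK !ImE !(rmorphD, rmorphM) /= ?conjCK /=; ring.
by rewrite !addr_ge0 // mulr_ge0 // ?exprn_ge0 // ltW.
Qed.

(** * Sums with a factor z below a threshold *)

Section Sequence.
Variables (I : finType) (r : I -> nat) (f : I -> C).
Hypothesis f_sector : forall i j, (r i <= r j)%N -> in_sector (f i) (f j).

Definition split_sum (m : nat) : C :=
  \sum_i (if (r i < m)%N then z else 1) * f i.

(** Raising the threshold from [m] to [p] changes only the block of ranks in [m, p), whose sum gets
    multiplied by [z]. *)
Lemma split_sum_sector (m p : nat) :
  (m <= p)%N -> in_sector (split_sum m) (split_sum p).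
Proof.
move=> mp.
pose a := \sum_(i | (r i < m)%N) f i.
pose b := \sum_(i | (m <= r i < p)%N) f i.
pose c := \sum_(i | (p <= r i)%N) f i.
have -> : split_sum m = z * a + b + c.
  rewrite /split_sum (bigID (fun i => r i < m)%N) /= -addrA; congr (_ + _).
    by rewrite mulr_sumr; apply: eq_bigr => i ->.
  rewrite (bigID (fun i => r i < p)%N) /=; congr (_ + _).
    by apply: eq_big => [i|i /andP[/negbTE-> _]]; rewrite ?mul1r -?leqNgt.
  apply: eq_big => [i|i /andP[/negbTE-> _]]; rewrite ?mul1r -?leqNgt //; lia.
have -> : split_sum p = z * a + z * b + c.
  rewrite /split_sum (bigID (fun i => r i < p)%N) /=; congr (_ + _).
    rewrite -mulrDr (bigID (fun i => r i < m)%N) /= mulrDr !mulr_sumr.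
    by congr (_ + _); apply: eq_big => [i|i /andP[-> _]] //; lia.
  by apply: eq_big => [i|i /negbTE->]; rewrite ?mul1r -?leqNgt.
apply: in_sector_step; apply: in_sector_sum => i j Pi Pj; apply: f_sector; lia.
Qed.

(** The pivot has the least rank that is at least [m], or the greatest rank if all are below [m]. *)
Lemma split_pivot (m : nat) (i0 : I) :
  exists i, forall j, if (r j < m)%N then (r j <= r i)%N else (r i <= r j)%N.
Proof.
have [/existsP[i1 i1m]|/existsPn lt_m] := boolP [exists i, (m <= r i)%N].
  case: (@arg_minnP _ i1 (fun i => m <= r i)%N r i1m) => i mi min_i; exists i => j.
  by case: ltnP => [jm|/min_i//]; apply: ltnW; apply: leq_trans jm mi.
case: (@arg_maxnP _ i0 predT r erefl) => i _ max_i; exists i => j.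
by have := lt_m j; rewrite -ltnNge => ->; apply: max_i.
Qed.

(* All the terms of the sum lie in the sector spanned by [f i] and [z * f i] for a
   pivot [i]; that sector is pointed, so nothing cancels. *)
Lemma split_sum_neq0 (m : nat) (i0 : I) :
  (forall i, f i != 0) -> split_sum m != 0.
Proof.
move=> f_neq0; have [i pivot] := split_pivot m i0.
pose w j := (if (r j < m)%N then z else 1) * f j.
have w_sector j : in_sector (f i) (w j).
  rewrite /w; have := pivot j; case: ifP => _ le_r; last by rewrite mul1r f_sector.
  by apply: in_sector_mul; apply: f_sector.
have : in_sector (f i) (\sum_(j | j != i) w j).
  have -> : f i = \sum_(k | k == i) f k by rewrite big_pred1_eq.
  by apply: in_sector_sum => k j /eqP->.
case/andP => rest1 rest2.
have pos : 0 < 'Im z * `|f i| ^+ 2 by rewrite mulr_gt0 // exprn_gt0 // normr_gt0.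
apply/eqP => sum0.
have sumE : w i + \sum_(j | j != i) w j = 0 by move: sum0; rewrite /split_sum (bigD1 i).
(* The pivot term is [z * f i] or [f i]; accordingly the first or the second sector condition is
   strict for it, with imaginary part ['Im z * |f i|^2]. *)
have [im|im] : 0 < 'Im (w i * (f i)^*) \/ 0 < 'Im (z * f i * (w i)^*).
  rewrite /w; case: ifP => _; [left|right]; by rewrite ?mul1r Im_mul_norm.
  have := ltr_wpDr rest1 im.
  by rewrite -raddfD -mulrDl sumE mul0r raddf0 ltxx.
have := ltr_wpDr rest2 im.
by rewrite -raddfD -mulrDr -rmorphD sumE rmorph0 mulr0 raddf0 ltxx.
Qed.

End Sequence.
End Sector.

(** * Deleting the first letter of a signed permutation *)

Definition lift_letter (n : nat) (j : 'I_n.+1) (y : letter n) : letter n.+1 :=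
  (lift j y.1, y.2).

Lemma lift_letter_inj n (j : 'I_n.+1) : injective (lift_letter j).
Proof. by move=> [i b] [k c] [e ->]; congr pair; apply/(@lift_inj _ j)/val_inj. Qed.

(** The inverse of deleting the first letter [x] and standardizing the absolute values of the
    others. *)
Definition signed_lift_fun n (x : letter n.+1) (s : {perm (letter n)})
    (u : letter n.+1) : letter n.+1 :=
  if unlift ord0 u.1 is Some i then lift_letter x.1 (s (i, u.2))
  else (x.1, x.2 (+) u.2).

Lemma signed_lift_fun_inj n (x : letter n.+1) s : injective (signed_lift_fun x s).
Proof.
case=> [i b] [k c]; rewrite /signed_lift_fun /=.
case: unliftP => [i' ->|->]; case: unliftP => [k' ->|->] //.
- by move/lift_letter_inj/perm_inj => -[-> ->].
- by move/(congr1 fst)/eqP; rewrite eq_sym (negbTE (neq_lift _ _)).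
- by move/(congr1 fst)/eqP; rewrite (negbTE (neq_lift _ _)).
- by case=> /addbI->.
Qed.

Definition signed_lift n (x : letter n.+1) (s : {perm (letter n)}) :
  {perm (letter n.+1)} := perm (@signed_lift_fun_inj n x s).

Lemma signed_lift0 n (x : letter n.+1) s b :
  signed_lift x s (ord0, b) = (x.1, x.2 (+) b).
Proof. by rewrite permE /signed_lift_fun unlift_none. Qed.

Lemma signed_lift_lift n (x : letter n.+1) s (i : 'I_n) b :
  signed_lift x s (lift ord0 i, b) = lift_letter x.1 (s (i, b)).
Proof. by rewrite permE /signed_lift_fun liftK. Qed.

Lemma signed_lift_inj n (x : letter n.+1) : injective (signed_lift x).
Proof.
move=> s s' e; apply/permP => -[i b]; apply: (@lift_letter_inj _ x.1).
by rewrite -!signed_lift_lift e.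
Qed.

Lemma signed_permP n (s : {perm (letter n)}) :
  reflect (forall u, s (letter_opp u) = letter_opp (s u)) (s \in signed_perms n).
Proof. by rewrite inE; apply: (iffP forallP) => h u; apply/eqP. Qed.

Lemma signed_perm_lift_neq n (p : {perm (letter n.+1)}) (u : letter n) :
  p \in signed_perms n.+1 -> (p (ord0, false)).1 != (p (lift ord0 u.1, u.2)).1.
Proof.
move/signed_permP => sp; apply/eqP => e.
have [e2|e2] := eqVneq (p (ord0, false)).2 (p (lift ord0 u.1, u.2)).2.
  have /perm_inj[] // : p (ord0, false) = p (lift ord0 u.1, u.2).
  by case: (p _) (p _) e e2 => [? ?] [? ?] /= -> ->.
have /perm_inj[] // : p (letter_opp (ord0, false)) = p (lift ord0 u.1, u.2).
rewrite sp /letter_opp; case: (p _) (p _) e e2 => [i b] [k c] /= -> bc.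
by congr pair; case: b c bc => [] [].
Qed.

Definition signed_first n (x : letter n.+1) : {set {perm (letter n.+1)}} :=
  [set p in signed_perms n.+1 | p (ord0, false) == x].

Lemma signed_firstE n (x : letter n.+1) :
  signed_first x = signed_lift x @: signed_perms n.
Proof.
apply/setP => p; rewrite inE; apply/andP/imsetP => [[sp /eqP px]|[s ss ->]].
  have neq u := signed_perm_lift_neq u sp; rewrite px in neq.
  (* The default [u.1] is never reached: by [neq], no later letter has the absolute value of [x]. *)
  pose s0 u := (odflt u.1 (unlift x.1 (p (lift ord0 u.1, u.2)).1),
                (p (lift ord0 u.1, u.2)).2) : letter n.
  have s0K u : lift_letter x.1 (s0 u) = p (lift ord0 u.1, u.2).
    rewrite /lift_letter /=; case: (unlift_some (neq u)) => k e -> /=.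
    by rewrite -e; case: (p _).
  have s0_inj : injective s0.
    move=> u v /(congr1 (lift_letter x.1)); rewrite !s0K.
    by move/perm_inj/(@lift_letter_inj _ ord0).
  exists (perm s0_inj).
    apply/signed_permP => u; apply: (@lift_letter_inj _ x.1).
    rewrite !permE s0K -[_ (letter_opp (s0 u))]/(letter_opp (lift_letter x.1 (s0 u))).
    by rewrite s0K; move/signed_permP: sp => <-.
  apply/permP => -[i b]; case: (unliftP ord0 i) => [k ->|->]; last first.
    rewrite signed_lift0; case: b => /=; last by rewrite addbF px; case: (x).
    move/signed_permP: sp => /(_ (ord0, false)); rewrite px /letter_opp /= => ->.
    by rewrite addbT.
  by rewrite signed_lift_lift permE s0K.
rewrite signed_lift0 addbF; split; last by case: (x).
apply/signed_permP => -[i b]; rewrite /letter_opp /=.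
case: (unliftP ord0 i) => [k ->|->]; last by rewrite !signed_lift0 addbN.
rewrite !signed_lift_lift; move/signed_permP: ss => /(_ (k, b)).
by rewrite /letter_opp /= => ->.
Qed.

(** * Descents under deletion of the first letter *)

Lemma letter_val_lt0 n (x : letter n) : (letter_val x < 0) = x.2.
Proof. by case: x => i []; rewrite /letter_val /= ?expr1 ?expr0; lia. Qed.

Lemma letter_val_lift n (j : 'I_n.+1) (x y : letter n) :
  (letter_val (lift_letter j x) < letter_val (lift_letter j y)) =
  (letter_val x < letter_val y).
Proof.
case: x y => [i b] [k c]; rewrite /letter_val /= /bump.
by case: b c => [] []; rewrite ?expr1 ?expr0 /=; lia.
Qed.

Lemma desB_sum n (p : {perm (letter n)}) :
  desB p = (\sum_(i < n) ((window p)`_i.+1 < (window p)`_i)%R)%N.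
Proof.
rewrite /desB -sum1_card big_mkcond; apply: eq_bigr => i _.
by rewrite inE; case: (_ < _).
Qed.

Lemma desB_recl n (p : {perm (letter n.+1)}) :
  desB p = ((p (ord0, false)).2 +
    \sum_(i < n) (letter_val (p (lift ord0 i, false)) < (window p)`_i.+1)%R)%N.
Proof.
rewrite desB_sum big_ord_recl; congr (_ + _)%N.
  by rewrite (nth_window _ ord0) letter_val_lt0.
by apply: eq_bigr => i _; rewrite nth_window.
Qed.

Lemma desB_signed_lift0 (x : letter 1) (s : {perm (letter 0)}) :
  desB (signed_lift x s) = x.2.
Proof. by rewrite desB_recl big_ord0 addn0 signed_lift0 /= addbF. Qed.

(** The comparison of 0 with the first letter of [s] gives way to those of 0 with [x] and of [x]
    with the lifted letter; later ones persist because lifting is monotone. *)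
Lemma desB_signed_lift n (x : letter n.+2) (s : {perm (letter n.+1)}) :
  (desB (signed_lift x s) + (s (ord0, false)).2 =
   x.2 + (letter_val (lift_letter x.1 (s (ord0, false))) < letter_val x)%R
   + desB s)%N.
Proof.
have lift0 : signed_lift x s (ord0, false) = x.
  by rewrite signed_lift0 addbF; case: (x).
rewrite !desB_recl lift0 big_ord_recl (nth_window _ (@ord0 n.+1)) lift0 signed_lift_lift.
rewrite -!addnA; congr (_ + (_ + _))%N; rewrite addnC; congr (_ + _)%N.
apply: eq_bigr => i _.
have -> : (lift ord0 i).+1 = i.+2 by [].
have i0 : (i < n.+1)%N by rewrite ltnS ltnW.
rewrite (nth_window _ (lift ord0 (Ordinal i0))) (nth_window _ (Ordinal i0)).
by rewrite !signed_lift_lift letter_val_lift.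
Qed.

(* Position in the order 1, ..., n, -n, ..., -1. *)
Definition letter_rank n (x : letter n) : nat :=
  if x.2 then (n.*2.-1 - x.1)%N else x.1.

(** The number [letter_rank x - x.2] counts the lifted letters that precede [x] in the order: a
    negative [x] is also preceded by its opposite, which is not a lifted letter. *)
Lemma letter_rank_threshold n (x : letter n.+2) (y : letter n.+1) :
  (x.2 + (letter_val (lift_letter x.1 y) < letter_val x)%R =
   (letter_rank y < letter_rank x - x.2) + y.2)%N.
Proof.
case: x y => [i b] [k c]; rewrite /letter_rank /letter_val /= /bump.
by case: b c => [] []; rewrite ?expr1 ?expr0 /=; have := ltn_ord i; have := ltn_ord k; lia.
Qed.

(** * The recurrence and real-rootedness *)

Definition B_letter (R : realType) n (x : letter n.+1) : {poly R} :=
  \sum_(p in signed_first x) 'X^(desB p).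

Lemma B_polyE (R : realType) n (x : letter n.+1) :
  B_poly R n.+1 (letter_val x) = B_letter R x.
Proof.
apply: eq_bigl => p; rewrite !inE (nth_window _ ord0).
by rewrite (inj_eq (@letter_val_inj _)).
Qed.

Lemma B_letter0 (R : realType) (x : letter 1) : B_letter R x = 'X^(x.2).
Proof.
rewrite /B_letter signed_firstE big_imset /=; last by move=> s s' _ _ /signed_lift_inj.
rewrite (big_pred1 1%g) ?desB_signed_lift0 // => s.
have -> : s = 1%g by apply/permP => -[[]].
by rewrite /= eqxx; apply/signed_permP => -[[]].
Qed.

Lemma B_letterS (R : realType) n (x : letter n.+2) :
  B_letter R x =
  \sum_(y : letter n.+1)
    (if (letter_rank y < letter_rank x - x.2)%N then 'X else 1) * B_letter R y.
Proof.
rewrite /B_letter signed_firstE big_imset /=; last by move=> s s' _ _ /signed_lift_inj.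
rewrite (partition_big (fun s : {perm letter n.+1} => s (ord0, false)) predT) //=.
apply: eq_bigr => y _; rewrite mulr_sumr.
apply: eq_big => [s|s /andP[_ /eqP sy]]; first by rewrite [RHS]inE.
have := desB_signed_lift x s; rewrite sy letter_rank_threshold addnAC.
move/addIn => ->; case: ifP => _; by rewrite ?mul1r // exprS.
Qed.

Lemma B_letter_sector (R : realType) n (z : R[i]) (x y : letter n.+1) :
  0 < 'Im z -> (letter_rank x <= letter_rank y)%N ->
  let f x := (map_poly (real_complex R) (B_letter R x)).[z] in
  in_sector z (f x) (f y) && (f x != 0).
Proof.
move=> z_gt0 + /=; elim: n x y => [|n IHn] x y.
  have z_neq0 : z != 0.
    by apply: contraTneq z_gt0 => ->; rewrite raddf0 ltxx.
  (* For one letter the values are 1 and [z], in the order of ranks. *)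
  rewrite !B_letter0 !map_polyXn !hornerXn expf_neq0 // andbT.
  case: x y => [[i i1] b] [[k k1] c]; rewrite /letter_rank /=.
  case: b c => [] [] // ik; rewrite ?expr1 ?expr0; try exact: in_sector_refl.
    by exfalso; lia.
  by rewrite -[z in in_sector _ _ z]mulr1 in_sector_mul ?in_sector_refl.
have eval_step u : (map_poly (real_complex R) (@B_letter R n.+1 u)).[z] =
    split_sum z (@letter_rank n.+1)
      (fun v => (map_poly (real_complex R) (B_letter R v)).[z])
      (letter_rank u - u.2).
  rewrite B_letterS rmorph_sum horner_sum; apply: eq_bigr => v _.
  by rewrite rmorphM hornerM; case: ifP => _ /=;
     rewrite ?map_polyX ?hornerX ?rmorph1 ?hornerC.
move=> xy; rewrite !eval_step; apply/andP; split.
  apply: split_sum_sector => // [u v uv|]; first by have /andP[] := IHn u v uv.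
  (* The threshold is monotone: the correction by 1 sets in between positive and negative letters,
     where the rank strictly increases. *)
  case: x y xy => [i b] [k c]; rewrite /letter_rank /=.
  by case: b c => [] []; have := ltn_ord i; have := ltn_ord k; lia.
(* The letter [(ord0, false)] only witnesses that there is a letter. *)
apply: split_sum_neq0 (ord0, false) _ => // [u v uv|u].
  by have /andP[] := IHn u v uv.
by have /andP[] := IHn u u (leqnn _).
Qed.

Lemma B_letter_real_rooted (R : realType) n (x : letter n.+1) :
  real_rooted (B_letter R x).
Proof.
have upper (z : R[i]) : root (map_poly (real_complex R) (B_letter R x)) z ->
    ~~ (0 < 'Im z).
  move=> /rootP pz0; apply/negP => z_gt0.
  by have /andP[_] := B_letter_sector z_gt0 (leqnn (letter_rank x)); rewrite pz0 eqxx.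
move=> z pz0; have conj_real p : map_poly Num.conj (map_poly (real_complex R) p)
    = map_poly (real_complex R) p.
  rewrite -map_poly_comp; apply: eq_map_poly => a /=.
  by apply/CrealP; rewrite complex_real.
have pzC0 : root (map_poly (real_complex R) (B_letter R x)) z^*.
  by rewrite -conj_real fmorph_root.
have := upper _ pz0; have := upper _ pzC0; rewrite Im_conj oppr_gt0 => im1 im2.
apply/Creal_ImP; have := Creal_Im z.
by rewrite realE => /orP[]; rewrite le_eqVlt ?(negPf im1) ?(negPf im2) orbF => /eqP.
Qed.

Theorem theorem9 (R : realType) (n k : nat) (hk : (1 <= k <= n)%N) :
  real_rooted (B_poly R n k%:Z) /\ real_rooted (B_poly R n (- k%:Z)).
Proof.
case: n hk => [|n] hk; first by case: k hk.
have real_rooted_B (m : int) : `|m|%N = k -> real_rooted (B_poly R n.+1 m).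
  move=> mk; have /letter_valP[x <-] : (0 < `|m| <= n.+1)%N by rewrite mk.
  by rewrite B_polyE; apply: B_letter_real_rooted.
by split; apply: real_rooted_B; rewrite ?abszN.
Qed.
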